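(* For every positive integer $n$, the following identity holds in $\mathbb{Z}[[z_0,\ldots,z_n]]$: \[ \sum_{ k \ge 0 } \prod_{ j=1 }^n [2k+1]_{ z_j } z_0^k \ = \ \sum_{ (\pi,\epsilon)\in B_n } \frac{ \displaystyle z_0^{\left\lceil \operatorname{ch}(\epsilon)/2 \right\rceil } \prod_{j:a_j^\epsilon=1}z_{\pi(1)}z_{\pi(2)}\cdots z_{\pi(j)} \prod_{\substack{j\in \mathrm{Des}(\pi) \\ a_j^\epsilon=0 }}z_0z_{\pi(1)}^2z_{\pi(2)}^2\cdots z_{\pi(j)}^2 }{ \displaystyle \prod_{ j=0 }^n \left( 1 - z_0 \, z_{\pi(1) }^{2} z_{\pi(2) }^{2} \cdots z_{\pi(j)}^{2} \right) } \, , \] where the $j=0$ factor of the denominator is $1-z_0$.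
   Context: $[m]_z=1+z+\cdots+z^{m-1}$; $\mathrm{Des}(\pi)=\{j\in[n-1]:\pi(j)>\pi(j+1)\}$ for $\pi\in S_n$. $B_n$ is the set of signed permutations $(\pi,\epsilon)$ with $\pi\in S_n$, $\epsilon\in\{\pm1\}^n$. Write $c_j=0$ if $\epsilon_j=1$ and $c_j=1$ if $\epsilon_j=-1$, set $c_{n+1}=0$, define $a_j^\epsilon=(c_j-c_{j+1})\bmod 2$ for $j\in[n]$, and $\operatorname{ch}(\epsilon)=\sum_{j=1}^n a_j^\epsilon$. *)

(* Defs.v *)
From HB Require Import structures.
From mathcomp Require Import all_boot all_order all_fingroup all_algebra.
From mathcomp Require Import boolp.
From mathcomp Require Import mpoly.

Set Implicit Arguments.
Unset Strict Implicit.
Unset Printing Implicit Defensive.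

Import GRing.Theory.
Local Open Scope ring_scope.

(* The ring R[[z_0, ..., z_(n-1)]]: a series is its family of coefficients,   *)
(* indexed by the monomials 'X_{1..n} of multinomials.                        *)
Record mfps (n : nat) (R : Type) := MFPS { mfps_coef : 'X_{1..n} -> R }.

Lemma mfpsP n R (f g : mfps n R) : mfps_coef f =1 mfps_coef g <-> f = g.
Proof.
split=> [|-> //]; case: f g => [f] [g] /= fg.
by congr MFPS; apply/funext.
Qed.

HB.instance Definition _ n R := gen_eqMixin (mfps n R).
HB.instance Definition _ n R := gen_choiceMixin (mfps n R).

Section Zmodule.
Variables (n : nat) (R : zmodType).
Implicit Types f g h : mfps n R.

Definition mfps_zero : mfps n R := MFPS (fun=> 0).
Definition mfps_opp f := MFPS (fun m => - mfps_coef f m).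
Definition mfps_add f g := MFPS (fun m => mfps_coef f m + mfps_coef g m).

Fact mfps_addA : associative mfps_add.
Proof. by move=> f g h; apply/mfpsP=> m /=; rewrite addrA. Qed.
Fact mfps_addC : commutative mfps_add.
Proof. by move=> f g; apply/mfpsP=> m /=; rewrite addrC. Qed.
Fact mfps_add0 : left_id mfps_zero mfps_add.
Proof. by move=> f; apply/mfpsP=> m /=; rewrite add0r. Qed.
Fact mfps_addN : left_inverse mfps_zero mfps_opp mfps_add.
Proof. by move=> f; apply/mfpsP=> m /=; rewrite addNr. Qed.

HB.instance Definition _ := GRing.isZmodule.Build (mfps n R)
  mfps_addA mfps_addC mfps_add0 mfps_addN.

Lemma mfps_coef0 m : mfps_coef (0 : mfps n R) m = 0.
Proof. by []. Qed.
Lemma mfps_coefN f m : mfps_coef (- f) m = - mfps_coef f m.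
Proof. by []. Qed.
Lemma mfps_coefD f g m : mfps_coef (f + g) m = mfps_coef f m + mfps_coef g m.
Proof. by []. Qed.
Lemma mfps_coefB f g m : mfps_coef (f - g) m = mfps_coef f m - mfps_coef g m.
Proof. by []. Qed.
Lemma mfps_coef_sum (I : Type) (r : seq I) (P : pred I) (F : I -> mfps n R) m :
  mfps_coef (\sum_(i <- r | P i) F i) m = \sum_(i <- r | P i) mfps_coef (F i) m.
Proof. by elim/big_rec2: _ => //= i x y _ <-. Qed.
End Zmodule.

Section Ring.
Variables (n : nat) (R : comNzRingType).
Implicit Types f g h : mfps n R.

Definition mfps_one : mfps n R := MFPS (fun m => (m == 0%MM)%:R).

(* Cauchy product; the bound on the total degrees only makes the index type   *)
(* finite, as in mcoeffM.                                                     *)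
Definition mfps_mul f g : mfps n R :=
  MFPS (fun m =>
    \sum_(k : 'X_{1..n < (mdeg m).+1, (mdeg m).+1} | m == (k.1 + k.2)%MM)
       mfps_coef f k.1 * mfps_coef g k.2).

Definition mfps_trunc (d : nat) f : {mpoly R[n]} :=
  \sum_(m : 'X_{1..n < d}) mfps_coef f m *: 'X_[m].

Lemma mcoeff_trunc d f m :
  (mfps_trunc d f)@_m = if (mdeg m < d)%N then mfps_coef f m else 0.
Proof.
rewrite raddf_sum /=; case: ifP => [lt_md|ge_md].
  rewrite (bigD1 (BMultinom lt_md)) //= mcoeffZ mcoeffX eqxx mulr1.
  rewrite big1 ?addr0 // => k ne_k; rewrite mcoeffZ mcoeffX.
  case: eqP => [e|]; last by rewrite mulr0.
  by case/eqP: ne_k; apply/val_inj.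
rewrite big1 // => k _; rewrite mcoeffZ mcoeffX.
case: eqP => [e|]; last by rewrite mulr0.
by move: (bmdeg k); rewrite e ge_md.
Qed.

Lemma mfps_mul_trunc d f g m : (mdeg m < d)%N ->
  mfps_coef (mfps_mul f g) m = (mfps_trunc d f * mfps_trunc d g)@_m.
Proof.
move=> lt_md; rewrite mcoeffM /=; apply: eq_bigr => k _.
by rewrite !mcoeff_trunc !(leq_trans (bmdeg _) lt_md).
Qed.

Lemma mcoeffM_eq (p p' q q' : {mpoly R[n]}) m :
    (forall k, (mdeg k <= mdeg m)%N -> p@_k = p'@_k) ->
    (forall k, (mdeg k <= mdeg m)%N -> q@_k = q'@_k) ->
  (p * q)@_m = (p' * q')@_m.
Proof.
move=> ep eq; rewrite !mcoeffM; apply: eq_bigr => k _.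
by rewrite ep ?eq // -ltnS bmdeg.
Qed.

Lemma mfps_trunc1 d : (0 < d)%N -> mfps_trunc d mfps_one = 1.
Proof.
move=> d_gt0; apply/mpolyP=> m; rewrite mcoeff_trunc mcoeff1 /=.
by case: eqP => [->|_]; [rewrite mdeg0 d_gt0 | rewrite if_same].
Qed.

Lemma mfps_truncD d f g :
  mfps_trunc d (f + g) = mfps_trunc d f + mfps_trunc d g.
Proof.
apply/mpolyP=> m; rewrite mcoeffD !mcoeff_trunc; case: ifP => //.
by rewrite addr0.
Qed.

Fact mfps_mulA : associative mfps_mul.
Proof.
move=> f g h; apply/mfpsP=> m; set d := (mdeg m).+1.
rewrite !(@mfps_mul_trunc d) //.
transitivity ((mfps_trunc d f * (mfps_trunc d g * mfps_trunc d h))@_m).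
  apply: mcoeffM_eq => // k le_km.
  by rewrite mcoeff_trunc ltnS le_km (@mfps_mul_trunc d) // ltnS.
rewrite mulrA; apply: mcoeffM_eq => // k le_km.
by rewrite mcoeff_trunc ltnS le_km (@mfps_mul_trunc d) // ltnS.
Qed.

Fact mfps_mulC : commutative mfps_mul.
Proof.
move=> f g; apply/mfpsP=> m.
by rewrite !(@mfps_mul_trunc (mdeg m).+1) // mulrC.
Qed.

Fact mfps_mul1 : left_id mfps_one mfps_mul.
Proof.
move=> f; apply/mfpsP=> m.
by rewrite (@mfps_mul_trunc (mdeg m).+1) // mfps_trunc1 // mul1r mcoeff_trunc leqnn.
Qed.

Fact mfps_mulDl : left_distributive mfps_mul +%R.
Proof.
move=> f g h; apply/mfpsP=> m; rewrite mfps_coefD.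
by rewrite !(@mfps_mul_trunc (mdeg m).+1) // mfps_truncD mulrDl mcoeffD.
Qed.

Fact mfps_one_neq0 : mfps_one != 0.
Proof.
apply/eqP=> /mfpsP /(_ 0%MM) /= /eqP.
by rewrite eqxx oner_eq0.
Qed.

HB.instance Definition _ := GRing.Zmodule_isComNzRing.Build (mfps n R)
  mfps_mulA mfps_mulC mfps_mul1 mfps_mulDl mfps_one_neq0.

Lemma mfps_coef1 m : mfps_coef (1 : mfps n R) m = (m == 0%MM)%:R.
Proof. by []. Qed.

Lemma mfps_coefM f g m :
  mfps_coef (f * g) m =
  \sum_(k : 'X_{1..n < (mdeg m).+1, (mdeg m).+1} | m == (k.1 + k.2)%MM)
     mfps_coef f k.1 * mfps_coef g k.2.
Proof. by []. Qed.

Definition mfps_unit : pred (mfps n R) := fun f => `[< exists g, g * f = 1 >].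

Definition mfps_inv f : mfps n R :=
  if pselect (exists g, g * f = 1) is left ex_g then projT1 (cid ex_g) else f.

Fact mfps_mulVf : {in mfps_unit, left_inverse 1 mfps_inv *%R}.
Proof.
move=> f /asboolP ex_g; rewrite /mfps_inv; case: pselect => // ex_g'.
by case: (cid ex_g').
Qed.

Fact mfps_unitPl f g : g * f = 1 -> mfps_unit f.
Proof. by move=> gf; apply/asboolP; exists g. Qed.

Fact mfps_inv_out : {in [predC mfps_unit], mfps_inv =1 id}.
Proof.
move=> f; rewrite inE /= => /asboolPn nex_g.
by rewrite /mfps_inv; case: pselect.
Qed.

HB.instance Definition _ := GRing.ComNzRing_hasMulInverse.Build (mfps n R)
  mfps_mulVf mfps_unitPl mfps_inv_out.

Definition mfpsX (i : 'I_n) : mfps n R := MFPS (fun m => (m == U_(i)%MM)%:R).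

(* Convergence of \sum_k F k to s for the product topology, R being discrete: *)
(* each coefficient of the partial sums is eventually that of s.              *)
Definition mfps_sums_to (F : nat -> mfps n R) (s : mfps n R) : Prop :=
  forall m : 'X_{1..n}, exists K : nat, forall N : nat, (K <= N)%N ->
    mfps_coef (\sum_(k < N) F k) m = mfps_coef s m.

Lemma mfps_coefX_lt f k m : mfps_coef f 0%MM = 0 -> (mdeg m < k)%N ->
  mfps_coef (f ^+ k) m = 0.
Proof.
move=> f0; elim: k m => // k IHk m lt_mk.
rewrite exprS mfps_coefM big1 // => -[a b] /= /eqP e.
have [a0|a_neq0] := eqVneq (a : 'X_{1..n}) 0%MM; first by rewrite a0 f0 mul0r.
rewrite IHk ?mulr0 //; rewrite ltnS in lt_mk; apply: leq_trans lt_mk.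
have /= := congr1 mdeg e; rewrite mdegD => ed.
apply: leq_trans (eq_leq (esym ed)).
by rewrite -[X in (X < _)%N]add0n ltn_add2r lt0n mdeg_eq0.
Qed.

(* Ensures that the quotients below have invertible denominators. *)
Lemma mfps_unit_coef1 f : mfps_coef f 0%MM = 1 -> f \is a GRing.unit.
Proof.
move=> f0; pose h := 1 - f.
have h0 : mfps_coef h 0%MM = 0 by rewrite mfps_coefB mfps_coef1 eqxx f0 subrr.
pose G d := \sum_(k < d) h ^+ k.
pose g : mfps n R := MFPS (fun m => mfps_coef (G (mdeg m).+1) m).
suff gf : g * f = 1.
  by apply/unitrPr; exists g; rewrite mulrC.
have gE d m : (mdeg m < d)%N -> mfps_coef g m = mfps_coef (G d) m.
  move=> lt_md; rewrite /= /G !mfps_coef_sum.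
  rewrite -(subnKC lt_md) big_split_ord /= [X in _ + X]big1 ?addr0 // => i _.
  by rewrite mfps_coefX_lt //= ltnS leq_addr.
apply/mfpsP => m; pose d := (mdeg m).+1.
have -> : mfps_coef (g * f) m = mfps_coef (G d * f) m.
  rewrite !mfps_coefM; apply: eq_bigr => k _.
  by rewrite (gE d _ (bmdeg k.1)).
have -> : G d * f = 1 - h ^+ d.
  have -> : f = 1 - h by rewrite /h opprB addrC subrK.
  rewrite /G; move: (h) => x.
  by rewrite -[RHS]opprB subrX1 -mulNr opprB mulrC.
by rewrite mfps_coefB [X in _ - X]mfps_coefX_lt ?subr0.
Qed.

End Ring.

Definition qint (A : nzRingType) (m : nat) (z : A) : A := \sum_(i < m) z ^+ i.

(* Indices in [n] are shifted: the position j in [n] is the i : 'I_n with     *)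
(* j = i + 1, and similarly for the values of a permutation.                  *)

Definition Des n (p : 'S_n) : {set 'I_n} :=
  [set i : 'I_n | [exists i' : 'I_n, (i' == i.+1 :> nat) && (p i' < p i)%N]].

(* A sign vector is given by booleans: the i-th sign is (-1) ^+ (e i), so     *)
(* that true stands for -1.                                                   *)
Definition signed_perm n : finType := ('S_n * {ffun 'I_n -> bool})%type.

Section Signs.
Variables (n : nat) (e : {ffun 'I_n -> bool}).

Definition sgn_c (i : nat) : nat := if insub i is Some j then e j else 0%N.

Definition sgn_a (i : 'I_n) : nat :=
  `| (((sgn_c i)%:Z - (sgn_c i.+1)%:Z) %% 2)%Z |%N.

Definition sgn_ch : nat := (\sum_(i < n) sgn_a i)%N.
End Signs.

Section Variables.
Variable n : nat.

Definition z0 : mfps n.+1 int := mfpsX int ord0.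
Definition z (i : 'I_n) : mfps n.+1 int := mfpsX int (lift ord0 i).

(* z_{p(1)} z_{p(2)} ... z_{p(j)} *)
Definition zprefix (p : 'S_n) (j : nat) : mfps n.+1 int :=
  \prod_(i < n | (i < j)%N) z (p i).

(* z_0 z_{p(1)}^2 z_{p(2)}^2 ... z_{p(j)}^2 *)
Definition zprefix2 (p : 'S_n) (j : nat) : mfps n.+1 int :=
  z0 * \prod_(i < n | (i < j)%N) z (p i) ^+ 2.
End Variables.

(* Main.v *)
Require Import Defs.
From mathcomp Require Import all_boot all_order all_fingroup all_algebra.
From mathcomp Require Import mpoly zify.
Import GRing.Theory.
Local Open Scope ring_scope.

(** The coefficient of [z^m] on the left is 1 if [m_j <= 2 m_0] for all [j],
    and 0 otherwise.  On the right, the summand of [(p, e)] is the indicator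
    series of a translated simplicial cone of exponents [m].  Such an [m] lies
    in this cone iff [m_j <= 2 m_0] for all [j], the exponents [m_(p i)] weakly
    decrease with strict decrease at the descents of [p], and [e] records their
    parities: the number [a_j] is the parity of [m_(p j) - m_(p (j+1))], and
    the remaining even part of this difference gives the coordinate along the
    [j]-th generator.  Sorting the exponents, with ties broken by the index,
    shows that each [m] in the box lies in exactly one cone. *)

(** * Monomial series and indicator series of simplicial cones *)

Definition mfps_monom {n} (R : comNzRingType) (b : 'X_{1..n}) : mfps n R :=
  MFPS (fun m => (m == b)%:R).

Lemma mfps_coef_mulX {n} {R : comNzRingType} (f : mfps n R) (v m : 'X_{1..n}) :
  mfps_coef (f * mfps_monom R v) m =
    if (v <= m)%MM then mfps_coef f (m - v)%MM else 0.
Proof.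
rewrite mfps_coefM; case: ifPn => [le_vm | nle_vm]; last first.
  rewrite big1 // => k /eqP e /=; case: eqP => [ekv|]; last by rewrite mulr0.
  by case/negP: nle_vm; rewrite e ekv lem_addl.
have lt1 : (mdeg (m - v)%MM < (mdeg m).+1)%N.
  by have /(congr1 mdeg) := submK le_vm; rewrite mdegD; lia.
have lt2 : (mdeg v < (mdeg m).+1)%N.
  by have /(congr1 mdeg) := submK le_vm; rewrite mdegD; lia.
rewrite (bigD1 (BMultinom lt1, BMultinom lt2)) /= ?submK // eqxx mulr1.
rewrite big1 ?addr0 // => -[[k1 lt_k1] [k2 lt_k2]] /= /andP[/eqP e ne].
case: eqP => [ekv|]; last by rewrite mulr0.
case/eqP: ne; congr pair; apply: val_inj => //=.
by rewrite e ekv addmK.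
Qed.

Lemma mfps_monom0 {n} {R : comNzRingType} :
  mfps_monom R (0%MM : 'X_{1..n}) = 1.
Proof. exact/mfpsP. Qed.

Lemma mfps_monomD {n} {R : comNzRingType} (a b : 'X_{1..n}) :
  mfps_monom R (a + b)%MM = mfps_monom R a * mfps_monom R b.
Proof.
apply/mfpsP => m; rewrite mfps_coef_mulX /=.
case: ifPn => [le_bm | nle_bm].
  by congr (nat_of_bool _)%:R; apply/eqP/eqP => [->|<-]; rewrite ?addmK ?submK.
by case: eqP => // e; rewrite e lem_addl in nle_bm.
Qed.

Lemma mfps_monom_sum {n} {R : comNzRingType} (I : Type) (r : seq I)
    (P : pred I) (F : I -> 'X_{1..n}) :
  mfps_monom R (\sum_(i <- r | P i) F i)%MM =
    \prod_(i <- r | P i) mfps_monom R (F i).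
Proof. exact: (big_morph _ mfps_monomD mfps_monom0). Qed.

Lemma mfps_monomX {n} {R : comNzRingType} (a : 'X_{1..n}) k :
  mfps_monom R (a *+ k)%MM = mfps_monom R a ^+ k.
Proof.
elim: k => [|k IHk]; first by rewrite mulm0n mfps_monom0.
by rewrite mulmS mfps_monomD IHk exprS.
Qed.

Lemma mfps_unit_1Bmonom {n} {R : comNzRingType} (v : 'X_{1..n}) :
  v != 0%MM -> 1 - mfps_monom R v \is a GRing.unit.
Proof.
move=> v_neq0; apply: mfps_unit_coef1.
by rewrite mfps_coefB mfps_coef1 eqxx /= eq_sym (negbTE v_neq0) subr0.
Qed.

(* The hypothesis says that the vectors [v j] are linearly independent over
   the naturals, [tau] reading off the coordinates in the translated cone.
   Multiplying the indicator series of the cone by [1 - z^(v k)] leaves the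
   face on which the [k]-th coordinate vanishes. *)
Lemma mfps_simplicial_cone {n r} {R : comNzRingType} (b : 'X_{1..n})
    (v : 'I_r -> 'X_{1..n}) (tau : 'X_{1..n} -> 'I_r -> nat) :
    (forall (t : 'I_r -> nat) j, tau (b + \sum_i v i *+ t i)%MM j = t j) ->
  mfps_monom R b / \prod_j (1 - mfps_monom R (v j)) =
    MFPS (fun m => (m == b + \sum_i v i *+ tau m i)%MM%:R).
Proof.
move=> tauK.
pose M (t : 'I_r -> nat) : 'X_{1..n} := (b + \sum_i v i *+ t i)%MM.
have eqM t t' : t =1 t' -> M t = M t'.
  by move=> e; congr (_ + _)%MM; apply: eq_bigr => i _; rewrite e.
have MS t k : M (fun i => (i == k) + t i)%N = (M t + v k)%MM.
  rewrite /M -addmA; congr (_ + _)%MM.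
  apply/mnmP => i; rewrite mnmDE !mnm_sumE.
  rewrite (bigD1 k) //= [in RHS](bigD1 k) //= eqxx !mulmnE.
  rewrite (eq_bigr (fun j => (v j *+ t j)%MM i)); first by lia.
  by move=> j /negbTE ->.
have tauM t : tau (M t) =1 t by move=> j; exact: tauK.
(* If [v k] were zero, raising the [k]-th coordinate would not move the point, yet [tau] would read
   off a different value. *)
have v_neq0 k : v k != 0%MM.
  apply/eqP => vk0; have /(_ k) := tauM (fun i => (i == k) + 0)%N.
  by rewrite MS vk0 addm0 tauM eqxx.
have unitD : \prod_j (1 - mfps_monom R (v j)) \is a GRing.unit.
  by apply: rpred_prod => j _; exact: mfps_unit_1Bmonom.
apply: (mulIr unitD); rewrite divrK //.
(* The face of the cone whose first [k] coordinates vanish: the whole cone for [k = 0], the apex [b]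
   alone for [k = r]. *)
pose A k (m : 'X_{1..n}) : bool :=
  (m == M (tau m)) && [forall j : 'I_r, (j < k)%N ==> (tau m j == 0%N)].
have step (k : 'I_r) :
    MFPS (fun m => (A k m)%:R : R) * (1 - mfps_monom R (v k)) =
    MFPS (fun m => (A k.+1 m)%:R).
  apply/mfpsP => m; rewrite mulrBr mulr1 mfps_coefB mfps_coef_mulX /=.
  have AS : A k.+1 m = A k m && (tau m k == 0%N).
    rewrite /A -andbA; congr (_ && _).
    apply/forallP/andP => [h|[/forallP h h0] j].
      split; last by have := h k; rewrite leqnn.
      by apply/forallP => j; apply/implyP => lt; apply: (implyP (h j)); lia.
    apply/implyP; rewrite ltnS leq_eqVlt => /orP[/eqP e|]; last exact/implyP.
    by rewrite (val_inj e : j = k).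
  (* Translation by [v k] maps the face [A k] onto its points with nonzero [k]-th coordinate, so
     subtracting the shifted series leaves [A k.+1]. *)
  have AD : (v k <= m)%MM && A k (m - v k)%MM = A k m && (tau m k != 0%N).
    apply/andP/andP => [[le_vm /andP[/eqP e /forallP h]]|].
      have em : m = M (fun i => (i == k) + tau (m - v k)%MM i)%N.
        by rewrite MS -e submK.
      have tm j : tau m j = ((j == k) + tau (m - v k)%MM j)%N.
        by rewrite {1}em tauM.
      rewrite tm eqxx; split=> //; apply/andP; split.
        by apply/eqP; rewrite {1}em; apply: eqM => j; rewrite tm.
      apply/forallP => j; apply/implyP => lt; rewrite tm.
      have /negbTE-> : j != k by apply/eqP => e'; rewrite e' ltnn in lt.
      exact: (implyP (h j)).
    move=> [/andP[/eqP e /forallP h] tk].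
    pose t i := (tau m i - (i == k))%N.
    have em : m = (M t + v k)%MM.
      rewrite -MS e; apply: eqM => j; rewrite /t.
      by have [->|] := eqVneq j k; lia.
    rewrite {1 2}em addmK lem_addl; split=> //; apply/andP; split.
      by apply/eqP/eqM => j; rewrite tauM.
    apply/forallP => j; apply/implyP => lt; rewrite tauM /t.
    by rewrite (eqP (implyP (h j) lt)).
  rewrite AS -[if _ then _ else _](_ : (A k m && (tau m k != 0%N))%:R = _).
    by case: (A k m); case: (tau m k == 0%N); rewrite /= ?subrr ?subr0.
  by rewrite -AD; case: (v k <= m)%MM.
have prodA k : (k <= r)%N ->
    MFPS (fun m => (m == M (tau m))%:R : R) *
      \prod_(j < r | (j < k)%N) (1 - mfps_monom R (v j)) =
    MFPS (fun m => (A k m)%:R).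
  elim: k => [|k IHk] le_kr.
    rewrite big_pred0 // mulr1; apply/mfpsP => m /=; congr (nat_of_bool _)%:R.
    by rewrite /A; case: (_ == _) => //=; apply/esym/forallP.
  rewrite (bigD1 (Ordinal le_kr)) //= (eq_bigl (fun j : 'I_r => (j < k)%N)).
    rewrite [X in _ * X]mulrC mulrA IHk; last exact: ltnW.
    exact: (step (Ordinal le_kr)).
  by move=> j; rewrite -val_eqE /=; lia.
under [X in _ * X]eq_bigl => j do rewrite -(ltn_ord j).
rewrite prodA //; apply/mfpsP => m /=; congr (nat_of_bool _)%:R.
have Mtau0 : M (fun=> 0%N) = b.
  rewrite /M big1 ?addm0 // => i _; exact: mulm0n.
apply/eqP/andP => [->|[/eqP e /forallP h]].
  have tb0 j : tau b j = 0%N by rewrite -Mtau0 tauM.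
  split; last by apply/forallP => j; rewrite tb0 eqxx implybT.
  by rewrite -{1}Mtau0; apply/eqP/eqM => j; rewrite tb0.
rewrite e -Mtau0; apply: eqM => j.
by have := h j; rewrite ltn_ord /= => /eqP.
Qed.

(** * Coefficients of the left-hand side *)

(** Expanding the product gives one monomial [E f] per choice [f] of exponents in [[0, 2k]], and [f]
    can be recovered from [E f]; hence every coefficient is 0 or 1. *)
Lemma mfps_coef_box n k (m : 'X_{1..n.+1}) :
  mfps_coef ((\prod_(j < n) qint (2 * k + 1) (z j)) * z0 n ^+ k) m =
    ((m ord0 == k) && [forall j : 'I_n, m (lift ord0 j) <= 2 * k]%N)%:R.
Proof.
pose E (f : {ffun 'I_n -> 'I_(2 * k + 1)}) : 'X_{1..n.+1} :=
  (\sum_j U_(lift ord0 j) *+ f j + U_(ord0) *+ k)%MM.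
have E0 f : E f ord0 = k.
  rewrite mnmDE mnm_sumE big1 => [|j _]; rewrite mulmnE mnm1E ?eqxx ?mul1n //.
have EL f j : E f (lift ord0 j) = f j.
  rewrite mnmDE mnm_sumE (bigD1 j) //= big1 => [|i ne_ij].
    by rewrite !mulmnE !mnm1E eqxx mul1n !addn0.
  by rewrite mulmnE mnm1E (inj_eq lift_inj) (negbTE ne_ij).
rewrite bigA_distr_bigA big_distrl /= mfps_coef_sum.
have coefE (f : {ffun 'I_n -> 'I_(2 * k + 1)}) :
    mfps_coef (\prod_i z i ^+ f i * z0 n ^+ k) m = (m == E f)%:R.
  rewrite -[RHS]/(mfps_coef (mfps_monom int (E f)) m); congr (mfps_coef _ m).
  rewrite mfps_monomD mfps_monom_sum mfps_monomX; congr (_ * _).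
  by apply: eq_bigr => i _; rewrite mfps_monomX.
rewrite (eq_bigr _ (fun f _ => coefE f)).
case: (boolP (_ && _)) => [/andP[/eqP m0 /forallP mL]|nbox].
  have lt j : (m (lift ord0 j) < 2 * k + 1)%N by have := mL j; lia.
  pose f0 := [ffun j => Ordinal (lt j)].
  rewrite (bigD1 f0) //= big1 => [|f ne_f].
    rewrite (_ : m == E f0) //; apply/eqP/mnmP => i.
    by case: (unliftP ord0 i) => [j|] ->; rewrite ?E0 ?EL ?ffunE.
  case: eqP => // e; case/eqP: ne_f; apply/ffunP => j; apply: val_inj.
  by rewrite ffunE /= e EL.
rewrite big1 // => f _; case: eqP => // e; case/negP: nbox.
rewrite e E0 eqxx; apply/forallP => j; rewrite EL.
by have := ltn_ord (f j); lia.
Qed.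

(** * Exponent vectors of the summands on the right *)

Definition mnm_prefix {n} (p : 'S_n) (j : nat) : 'X_{1..n.+1} :=
  (\sum_(i < n | (i < j)%N) U_(lift ord0 (p i)))%MM.

Definition mnm_prefix2 {n} (p : 'S_n) (j : nat) : 'X_{1..n.+1} :=
  (U_(ord0) + \sum_(i < n | (i < j)%N) U_(lift ord0 (p i)) *+ 2)%MM.

Definition mnm_num {n} (p : 'S_n) (e : {ffun 'I_n -> bool}) : 'X_{1..n.+1} :=
  (U_(ord0) *+ uphalf (sgn_ch e)
   + \sum_(j < n | sgn_a e j == 1%N) mnm_prefix p j.+1
   + \sum_(j < n | (j \in Des p) && (sgn_a e j == 0%N)) mnm_prefix2 p j.+1)%MM.

Lemma zprefixE {n} (p : 'S_n) j : zprefix p j = mfps_monom int (mnm_prefix p j).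
Proof. by rewrite mfps_monom_sum. Qed.

Lemma zprefix2E {n} (p : 'S_n) j :
  zprefix2 p j = mfps_monom int (mnm_prefix2 p j).
Proof.
rewrite mfps_monomD mfps_monom_sum; congr (_ * _).
by apply: eq_bigr => i _; rewrite mfps_monomX.
Qed.

Lemma mnm_prefixE {n} (p : 'S_n) j i :
  mnm_prefix p j (lift ord0 (p i)) = (i < j)%N.
Proof.
rewrite mnm_sumE; under eq_bigr do rewrite mnm1E (inj_eq lift_inj) (inj_eq perm_inj).
rewrite big_mkcond (bigD1 i) //= eqxx big1 ?addn0; first by case: ifP.
by move=> k /negbTE ->; rewrite if_same.
Qed.

Lemma mnm_prefix_ord0 {n} (p : 'S_n) j : mnm_prefix p j ord0 = 0%N.
Proof. by rewrite mnm_sumE big1 // => i _; rewrite mnm1E. Qed.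

Lemma mnm_prefix2_sum {n} (p : 'S_n) j :
  mnm_prefix2 p j = (U_(ord0) + mnm_prefix p j *+ 2)%MM.
Proof.
congr (_ + _)%MM; apply/mnmP => i; rewrite mulmnE !mnm_sumE big_distrl.
by apply: eq_bigr => k _; rewrite mulmnE.
Qed.

Lemma mnm_prefix2E {n} (p : 'S_n) j i :
  mnm_prefix2 p j (lift ord0 (p i)) = (i < j)%N.*2.
Proof. by rewrite mnm_prefix2_sum mnmDE mulmnE mnm_prefixE mnm1E muln2. Qed.

Lemma mnm_prefix2_ord0 {n} (p : 'S_n) j : mnm_prefix2 p j ord0 = 1%N.
Proof. by rewrite mnm_prefix2_sum mnmDE mulmnE mnm_prefix_ord0 mnm1E eqxx. Qed.

Lemma numeratorE {n} (p : 'S_n) (e : {ffun 'I_n -> bool}) :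
  z0 n ^+ uphalf (sgn_ch e)
  * (\prod_(j < n | sgn_a e j == 1%N) zprefix p j.+1)
  * (\prod_(j < n | (j \in Des p) && (sgn_a e j == 0%N)) zprefix2 p j.+1)
  = mfps_monom int (mnm_num p e).
Proof.
rewrite !mfps_monomD !mfps_monom_sum mfps_monomX; congr (_ * _ * _).
  by apply: eq_bigr => i _; rewrite zprefixE.
by apply: eq_bigr => i _; rewrite zprefix2E.
Qed.

(* The exponents of [m] listed in the order of [p], followed by zeros. *)
Definition perm_exp {n} (p : 'S_n) (m : 'X_{1..n.+1}) (i : nat) : nat :=
  if insub i is Some j then m (lift ord0 (p j)) else 0%N.

Lemma perm_exp_ord {n} (p : 'S_n) (m : 'X_{1..n.+1}) (i : 'I_n) :
  perm_exp p m i = m (lift ord0 (p i)).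
Proof. by rewrite /perm_exp valK. Qed.

Lemma perm_exp_geq {n} (p : 'S_n) (m : 'X_{1..n.+1}) i :
  (n <= i)%N -> perm_exp p m i = 0%N.
Proof. by move=> le_ni; rewrite /perm_exp insubF // ltnNge le_ni. Qed.

Lemma sgn_a_le1 {n} (e : {ffun 'I_n -> bool}) i : (sgn_a e i <= 1)%N.
Proof. by rewrite /sgn_a; lia. Qed.

(** * Points of a cone and their coordinates *)

Definition des_even {n} (p : 'S_n) (e : {ffun 'I_n -> bool}) (i : 'I_n) : bool :=
  (i \in Des p) && (sgn_a e i == 0%N).

(** The drop in exponent from the variable at position [i] to the next one. Only factors with prefix
    length [i + 1] contribute: the two numerator products and the denominator factor indexed by
    [lift ord0 i]. *)
Definition cone_gap {n} (p : 'S_n) (e : {ffun 'I_n -> bool})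
    (t : 'I_n.+1 -> nat) (i : 'I_n) : nat :=
  (sgn_a e i + (des_even p e i + t (lift ord0 i)).*2)%N.

Definition cone_point {n} (p : 'S_n) (e : {ffun 'I_n -> bool})
    (t : 'I_n.+1 -> nat) : 'X_{1..n.+1} :=
  (mnm_num p e + \sum_(j < n.+1) mnm_prefix2 p j *+ t j)%MM.

(** The variable at position [k] occurs exactly in the prefixes of length [j + 1] with [k <= j], so
    its exponent is the sum of the gaps from [k] on. *)
Lemma cone_pointE {n} (p : 'S_n) (e : {ffun 'I_n -> bool}) t k :
  perm_exp p (cone_point p e t) k = (\sum_(j < n | k <= j) cone_gap p e t j)%N.
Proof.
have [le_nk|lt_kn] := leqP n k.
  rewrite perm_exp_geq // big_pred0 // => j.
  by have := ltn_ord j; lia.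
rewrite -[k]/(val (Ordinal lt_kn)); move: (Ordinal lt_kn) => {k lt_kn} i.
rewrite perm_exp_ord !mnmDE !mnm_sumE mulmnE mnm1E mul0n add0n /=.
rewrite big_ord_recl mulmnE mnm_prefix2E mul0n add0n /=.
rewrite [X in (X + _ + _)%N]big_mkcond [X in (_ + X + _)%N]big_mkcond.
rewrite [RHS]big_mkcond -!big_split /=; apply: eq_bigr => j _.
rewrite mulmnE mnm_prefixE !mnm_prefix2E ltnS /cone_gap -/(des_even p e j).
by have := sgn_a_le1 e j; case: (i <= j)%N; case: (des_even p e j);
  case: (sgn_a e j) => [|[]] //=; lia.
Qed.

(** The gaps sum to [sgn_ch e] plus an even number, and half of that even number is what [z_0]
    collects from the squared prefixes; the ceiling in the numerator becomes the [uphalf] of the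
    leading exponent. *)
Lemma cone_point_ord0 {n} (p : 'S_n) (e : {ffun 'I_n -> bool}) t :
  cone_point p e t ord0 =
    (uphalf (\sum_j cone_gap p e t j) + t ord0)%N.
Proof.
rewrite !mnmDE !mnm_sumE mulmnE mnm1E eqxx mul1n.
rewrite big1 => [|j _]; last exact: mnm_prefix_ord0.
rewrite big_mkcond big_ord_recl mulmnE mnm_prefix2_ord0 /=.
rewrite big_split /= -/(sgn_ch e).
rewrite (eq_bigr (fun i => nat_of_bool (des_even p e i))); last first.
  by move=> i _; rewrite mnm_prefix2_ord0 -/(des_even p e i); case: ifP.
rewrite [X in (_ + (_ + X))%N](eq_bigr (fun i => t (lift ord0 i))); last first.
  by move=> i _; rewrite mulmnE mnm_prefix2_ord0 mul1n.
rewrite -(big_morph double doubleD double0) big_split /=.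
by lia.
Qed.

Lemma sum_geq_ord {n} (F : 'I_n -> nat) (i : 'I_n) :
  (\sum_(j < n | i <= j) F j = F i + \sum_(j < n | i < j) F j)%N.
Proof.
rewrite (bigD1 i) //=; congr (_ + _)%N; apply: eq_bigl => j.
by rewrite -val_eqE /=; lia.
Qed.

(** The system is triangular: exponents vanish past the last position, so the gaps determine them
    from the end backwards. *)
Lemma cone_pointP {n} (p : 'S_n) (e : {ffun 'I_n -> bool}) t m :
  m = cone_point p e t <->
    (forall i : 'I_n, perm_exp p m i = cone_gap p e t i + perm_exp p m i.+1)%N
    /\ m ord0 = (uphalf (perm_exp p m 0) + t ord0)%N.
Proof.
split=> [->|[gap m0]].
  split=> [i|]; first by rewrite !cone_pointE sum_geq_ord.
  by rewrite cone_point_ord0 cone_pointE.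
have expE k : (k <= n)%N ->
    perm_exp p m (n - k) = (\sum_(j < n | n - k <= j) cone_gap p e t j)%N.
  elim: k => [|k IHk] le_kn.
    by rewrite -(cone_pointE p e t) !perm_exp_geq // subn0.
  have lt : (n - k.+1 < n)%N by lia.
  rewrite -[(n - k.+1)%N]/(val (Ordinal lt)) gap sum_geq_ord /=.
  by rewrite (_ : (n - k.+1).+1 = n - k)%N ?IHk //; lia.
have {}expE k : (k <= n)%N -> perm_exp p m k = perm_exp p (cone_point p e t) k.
  by move=> le_kn; rewrite cone_pointE -[k](subKn le_kn) expE // leq_subr.
apply/mnmP => i; case: (unliftP ord0 i) => [j|] ->.
  by rewrite -[j](permKV p) -!perm_exp_ord expE // ltnW.
by rewrite cone_point_ord0 m0 expE // cone_pointE.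
Qed.

(** Outside the cone the subtractions and the halving may truncate; membership is tested by
    comparing [m] with the point rebuilt from these values. *)
Definition cone_coord {n} (p : 'S_n) (e : {ffun 'I_n -> bool})
    (m : 'X_{1..n.+1}) (j : 'I_n.+1) : nat :=
  if unlift ord0 j is Some i then
    ((perm_exp p m i - perm_exp p m i.+1 - sgn_a e i)./2 - des_even p e i)%N
  else (m ord0 - uphalf (perm_exp p m 0))%N.

Lemma cone_coordK {n} (p : 'S_n) (e : {ffun 'I_n -> bool}) t j :
  cone_coord p e (cone_point p e t) j = t j.
Proof.
have /cone_pointP[gap m0] := erefl (cone_point p e t).
rewrite /cone_coord; case: unliftP => [i|] ->; last by rewrite m0 addKn.
by rewrite gap addnK addKn doubleK addKn.
Qed.

Lemma summandE {n} (w : signed_perm n) :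
  (z0 n ^+ uphalf (sgn_ch w.2)
   * (\prod_(j < n | sgn_a w.2 j == 1%N) zprefix w.1 j.+1)
   * (\prod_(j < n | (j \in Des w.1) && (sgn_a w.2 j == 0%N))
        zprefix2 w.1 j.+1))
  / \prod_(j < n.+1) (1 - zprefix2 w.1 j)
  = MFPS (fun m => (m == cone_point w.1 w.2 (cone_coord w.1 w.2 m))%:R).
Proof.
case: w => p e /=; rewrite numeratorE; under eq_bigr do rewrite zprefix2E.
by rewrite (mfps_simplicial_cone _ _ (cone_coord p e) (cone_coordK p e)).
Qed.

(** * Cone membership through sorting and parities *)

Lemma sgn_c_ord {n} (e : {ffun 'I_n -> bool}) (i : 'I_n) : sgn_c e i = e i.
Proof. by rewrite /sgn_c valK. Qed.

Lemma sgn_c_geq {n} (e : {ffun 'I_n -> bool}) i : (n <= i)%N -> sgn_c e i = 0%N.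
Proof. by move=> le_ni; rewrite /sgn_c insubF // ltnNge le_ni. Qed.

Lemma sgn_a_addb {n} (e : {ffun 'I_n -> bool}) i :
  sgn_a e i = odd (sgn_c e i) (+) odd (sgn_c e i.+1).
Proof.
rewrite /sgn_a sgn_c_ord oddb.
by case: (e i); rewrite /sgn_c; case: insub => [j|] //=; case: (e j).
Qed.

(* Weakly decreasing exponents, ties broken by the index: the order in which
   [p] has to list the variables for [m] to lie in its cone. *)
Definition exp_order {n} (m : 'X_{1..n.+1}) : rel 'I_n := fun i j =>
  ((m (lift ord0 j) < m (lift ord0 i))
   || (m (lift ord0 i) == m (lift ord0 j)) && (i <= j))%N.

Lemma exp_order_trans {n} (m : 'X_{1..n.+1}) : transitive (exp_order m).
Proof. by move=> j i k; rewrite /exp_order; lia. Qed.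

Lemma exp_order_anti {n} (m : 'X_{1..n.+1}) : antisymmetric (exp_order m).
Proof. by move=> i j; rewrite /exp_order => h; apply: val_inj => /=; lia. Qed.

Lemma exp_order_total {n} (m : 'X_{1..n.+1}) : total (exp_order m).
Proof. by move=> i j; rewrite /exp_order; lia. Qed.

Lemma sorted_map_permP {n} (r : rel 'I_n) (p : 'S_n) :
  reflect (forall i j : 'I_n, j = i.+1 :> nat -> r (p i) (p j))
    (sorted r [seq p i | i <- enum 'I_n]).
Proof.
have nthE x i : nth x [seq p i | i <- enum 'I_n] (nat_of_ord i) = p i.
  by rewrite (nth_map x) ?size_enum_ord // nth_ord_enum.
apply: (iffP idP) => [sp i j ij|rp].
  have /(sortedP (p i)) /(_ i) := sp.
  by rewrite size_map size_enum_ord -ij !nthE; apply.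
case: n r p nthE rp => [|n] r p nthE rp.
  by rewrite (size0nil (_ : size (enum 'I_0) = 0)%N) ?size_enum_ord.
apply/(sortedP ord0) => i; rewrite size_map size_enum_ord => lt_in.
rewrite (nthE _ (Ordinal (ltnW lt_in))) (nthE _ (Ordinal lt_in)).
exact: rp.
Qed.

Lemma perm_exp_mono {n} (p : 'S_n) (m : 'X_{1..n.+1}) k :
    (forall i : 'I_n, perm_exp p m i.+1 <= perm_exp p m i)%N ->
  (perm_exp p m k <= perm_exp p m 0)%N.
Proof.
move=> mono; elim: k => // k /(leq_trans _); apply.
have [le_nk|lt_kn] := leqP n k; last exact: (mono (Ordinal lt_kn)).
by rewrite perm_exp_geq // ltnW.
Qed.

(** The gap equations amount to the order and parity conditions; since the first exponent is the
    largest, the equation for [z_0] is solvable iff the box condition holds. *)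
Lemma cone_memE {n} (p : 'S_n) (e : {ffun 'I_n -> bool}) (m : 'X_{1..n.+1}) :
  (m == cone_point p e (cone_coord p e m)) =
  [&& sorted (exp_order m) [seq p i | i <- enum 'I_n],
      e == [ffun i => odd (m (lift ord0 (p i)))]
    & [forall j : 'I_n, m (lift ord0 j) <= 2 * m ord0]%N].
Proof.
apply/eqP/and3P => [/cone_pointP[]|[/sorted_map_permP srt /eqP ee /forallP box]].
  move: (cone_coord p e m) => t gap m0; split.
  (* A zero gap rules out a descent at [i], so ties are listed by increasing index. *)
  - apply/sorted_map_permP => i j ij; have := gap i.
    rewrite -ij !perm_exp_ord /cone_gap /des_even /exp_order.
    have : (p j < p i)%N -> i \in Des p.
      by move=> lt; rewrite inE; apply/existsP; exists j; rewrite ij eqxx.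
    by case: (i \in Des p); lia.
  - apply/eqP/ffunP => i; rewrite ffunE -perm_exp_ord.
    (* Both parities are zero at position [n], and each step back changes them by the same
       [sgn_a]. *)
    suff par k : (k <= n)%N ->
        odd (perm_exp p m (n - k)) = odd (sgn_c e (n - k)).
      have := par (n - i)%N (leq_subr _ _); rewrite subKn 1?ltnW // => ->.
      by rewrite sgn_c_ord oddb.
    elim: k => [|k IHk] le_kn.
      by rewrite subn0 perm_exp_geq ?sgn_c_geq.
    have lt : (n - k.+1 < n)%N by lia.
    have := IHk (ltnW le_kn); have -> : (n - k = (n - k.+1).+1)%N by lia.
    rewrite -[(n - k.+1)%N]/(val (Ordinal lt)) gap /cone_gap sgn_a_addb /=.
    rewrite !oddD odd_double addbF oddb => ->.
    by rewrite -addbA addbb addbF.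
  apply/forallP => j; rewrite -[j](permKV p) -perm_exp_ord.
  have := perm_exp_mono p m ((p^-1)%g j).
  by move=> /(_ (fun i => ltac:(rewrite [leqRHS]gap leq_addl))); lia.
have oddE k : odd (perm_exp p m k) = odd (sgn_c e k).
  have [le_nk|lt_kn] := leqP n k; first by rewrite perm_exp_geq ?sgn_c_geq.
  rewrite -[k]/(val (Ordinal lt_kn)) perm_exp_ord sgn_c_ord oddb.
  by rewrite [in RHS]ee ffunE.
apply/cone_pointP; split=> [i|]; last first.
  rewrite /cone_coord unlift_none; apply/esym/subnKC.
  have [n0|n_gt0] := posnP n; first by rewrite perm_exp_geq ?n0.
  by have := box (p (Ordinal n_gt0)); rewrite -perm_exp_ord /=; lia.
rewrite /cone_gap /cone_coord liftK.
(* The last position is followed by the default exponent 0 and is never a descent. *)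
have : (perm_exp p m i.+1 < perm_exp p m i)%N
       \/ (perm_exp p m i.+1 <= perm_exp p m i)%N /\ i \notin Des p.
  have [le_ni|lt_in] := leqP n i.+1.
    right; rewrite perm_exp_geq //; split=> //; rewrite inE.
    by apply/existsP => -[j /andP[/eqP ji _]]; have := ltn_ord j; lia.
  have := srt i (Ordinal lt_in) erefl.
  rewrite /exp_order -!perm_exp_ord /= => /orP[lt|/andP[/eqP-> le_p]].
    by left.
  right; split=> //; rewrite inE; apply/existsP => -[j /andP[/eqP ji]].
  by rewrite (_ : j = Ordinal lt_in) ?ltnNge ?le_p //; apply: val_inj.
have := oddE i; have := oddE i.+1; rewrite /des_even sgn_a_addb => <- <-.
move: (perm_exp p m i) (perm_exp p m i.+1) => x y.
(* A strict drop with [sgn_a] zero is even, hence at least 2, which leaves room for the 2 required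
   by [des_even]. *)
case=> [lt_yx|[le_yx /negbTE->]] /=; last by lia.
by case: (i \in Des p) => /=; lia.
Qed.

(** * Each exponent in the box lies in exactly one cone *)

Lemma sum_cone_mem {n} (m : 'X_{1..n.+1}) :
  \sum_(w : signed_perm n)
     (m == cone_point w.1 w.2 (cone_coord w.1 w.2 m))%:R =
  [forall j : 'I_n, m (lift ord0 j) <= 2 * m ord0]%N%:R :> int.
Proof.
under eq_bigr do rewrite cone_memE.
case: (boolP [forall j, _]) => _; last by rewrite big1 // => w _; rewrite !andbF.
(* Sorting the indices yields the only admissible permutation; uniqueness comes from antisymmetry of
   [exp_order]. *)
have /tuple_permP[p0 p0E] : perm_eq (sort (exp_order m) (enum 'I_n)) (ord_tuple n).
  by rewrite perm_sort.
have {}p0E : [seq p0 i | i <- enum 'I_n] = sort (exp_order m) (enum 'I_n).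
  by rewrite p0E; apply: eq_map => i; rewrite tnth_ord_tuple.
rewrite (bigD1 (p0, [ffun i => odd (m (lift ord0 (p0 i)))])) //=.
rewrite p0E (sort_sorted (exp_order_total m)) eqxx big1 ?addr0 //.
move=> [p e] /= ne; rewrite andbT; case: (boolP (sorted _ _)) => //= sp.
case: eqP => // ee; case/eqP: ne; rewrite ee.
suff -> : p = p0 by [].
have perm_enum q : perm_eq [seq fun_of_perm q i | i <- enum 'I_n] (enum 'I_n).
  apply: uniq_perm => [||i]; rewrite ?(map_inj_uniq perm_inj) ?enum_uniq //.
  by rewrite mem_enum; apply/mapP; exists ((q^-1)%g i); rewrite ?mem_enum ?permKV.
have pE : [seq p i | i <- enum 'I_n] = [seq p0 i | i <- enum 'I_n].
  apply: (sorted_eq (@exp_order_trans n m) (@exp_order_anti n m) sp).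
    by rewrite p0E; exact: (sort_sorted (exp_order_total m)).
  by rewrite (perm_trans (perm_enum p)) // perm_sym.
by apply/permP => i; move/eq_in_map: pE => /(_ i); apply; rewrite mem_enum.
Qed.

Theorem theorem6p10 (n : nat) (n_gt0 : (0 < n)%N) :
  mfps_sums_to
    (fun k : nat => (\prod_(j < n) qint (2 * k + 1) (z j)) * z0 n ^+ k)
    (\sum_(w : signed_perm n)
       (z0 n ^+ uphalf (sgn_ch w.2)
        * (\prod_(j < n | sgn_a w.2 j == 1%N) zprefix w.1 j.+1)
        * (\prod_(j < n | (j \in Des w.1) && (sgn_a w.2 j == 0%N))
             zprefix2 w.1 j.+1))
       / \prod_(j < n.+1) (1 - zprefix2 w.1 j)).
Proof.
(* Only the term [k = m ord0] contributes to the coefficient of [m]. *)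
move=> m; exists (m ord0).+1 => N lt_N.
rewrite !mfps_coef_sum; under eq_bigr do rewrite mfps_coef_box.
under [RHS]eq_bigr do rewrite summandE.
rewrite [RHS]sum_cone_mem (bigD1 (Ordinal lt_N)) //= eqxx big1 ?addr0 // => k.
by rewrite -val_eqE /= eq_sym => /negbTE->.
Qed.
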